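(* Let $\mathcal C$ be an $N$-dimensional asymptotic class of finite $L$-structures, and let $\mathcal D$ be a class of finite $L'$-structures that is uniformly parameter-interpretable in $\mathcal C$ by an interpretation $\mathcal I$ of arity $r$. Suppose that $\mathcal I$ admits a uniform definable selector and is selector-trace reflecting. Then $\mathcal D$ is an $N_*$-dimensional asymptotic class, where $$N_*=\operatorname{lcm}(1,2,\dots,Nr).$$ Moreover, the denominator can be sharpened by retaining only the positive exponents that actually occur in the size of the selector: $\mathcal D$ is an $L_S$-dimensional asymptotic class, where $L_S$ is the least common multiple of the essential selector dimensions (with $\operatorname{lcm}(\varnothing)=1$), and $L_S\mid \operatorname{lcm}(1,2,\dots,Nr)$.
   Context: Conventions. Languages $L,L'$ are countable first-order languages, possibly with finitely many sorts; function and constant symbols may be replaced by graph relations. All structures in the classes considered are finite, and $|M|$ is the total number of elements (summed over sorts). For a formula $\varphi(\bar x;\bar y)$ with $|\bar x|=n$, $\varphi(M^n;\bar a)=\{\bar b\in M^n: M\models\varphi(\bar b;\bar a)\}$. Uniform little-$o$. For a collection $\Phi$ (a ''cell'') of pairs $(M,\bar a)$, $f=o(g)$ uniformly on $\Phi$ means: for every $\varepsilon>0$ there is $Q$ with $|f(M,\bar a)|\le\varepsilon g(M,\bar a)$ for all $(M,\bar a)\in\Phi$ with $|M|>Q$. $N$-dimensional asymptotic class ($N\ge1$). A class $\mathcal C$ of finite $L$-structures such that for every $L$-formula $\varphi(x;\bar y)$ with a single object variable $x$ there are a finite set $D_\varphi\subseteq(\{0,\dots,N\}\times\mathbb R_{>0})\cup\{(0,0)\}$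 and, for each $(d,\mu)\in D_\varphi$, a parameter-free $L$-formula $\theta_{d,\mu}(\bar y)$ such that in every $M\in\mathcal C$ the sets $\theta_{d,\mu}(M^{|\bar y|})$ partition $M^{|\bar y|}$, and, uniformly on the cell $\{(M,\bar a):M\models\theta_{d,\mu}(\bar a)\}$, $|\varphi(M;\bar a)|=\mu|M|^{d/N}+o(|M|^{d/N})$; for $(0,0)$ this means $|\varphi(M;\bar a)|=o(1)$. Uniform parameter-interpretation $\mathcal I$ of $\mathcal D$ in $\mathcal C$, of arity $r\ge1$: an injection $\alpha:\mathcal D\to\mathcal C$; an integer $s\ge0$; fixed $L$-formulas $\delta(\bar u;\bar z)$, $\epsilon(\bar u,\bar v;\bar z)$ with $|\bar u|=|\bar v|=r$, $|\bar z|=s$; for each relation symbol $R\in L'$ a fixed $L$-formula $R^{\mathcal I}$ on the appropriate number of $r$-tuples (and $\bar z$); and for each $A\in\mathcal D$ a tuple $\bar c_A\in\alpha(A)^s$ and an $L'$-isomorphism $\iota_A:A\to X_A/E_A$, where $X_A=\delta(\alpha(A)^r;\bar c_A)$ and $E_A$ is the equivalence relation on $X_A$ defined by $\epsilon(\bar u,\bar v;\bar c_A)$; the formulas $R^{\mathcal I}$ (evaluated at $\bar c_A$) are $E_A$-invariant on $X_A$ and induce the $L'$-structure on $X_A/E_A$. A representative of $a\in A$ is an element of the class $\iota_A(a)$. Uniform definable selector: an $L$-formula $\sigma(\bar u;\bar z)$ such that for every $A\in\mathcal D$ the set $S_A=\sigma(\alpha(A)^r;\bar c_A)\subseteq X_A$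 meets every $E_A$-class in exactly one element (the selected representative). Selector-trace reflecting: for every $m\ge0$ and every parameter-free $L$-formula $\rho(\bar v_1,\dots,\bar v_m;\bar z)$ (each $\bar v_i$ an $r$-tuple, $|\bar z|=s$) there is a parameter-free $L'$-formula $\rho^{\downarrow}(y_1,\dots,y_m)$ such that for every $A\in\mathcal D$ and $\bar a\in A^m$ with selected representatives $\widetilde{\bar a}\in S_A^m$: $A\models\rho^{\downarrow}(\bar a)\iff\alpha(A)\models\rho(\widetilde{\bar a};\bar c_A)$. Essential selector dimensions. Since $\mathcal C$ is an $N$-dimensional asymptotic class, there is a finite family of parameter-free $L$-formulas $\chi_{e,\lambda}(\bar z)$, indexed by pairs $(e,\lambda)\in(\{0,\dots,Nr\}\times\mathbb R_{>0})\cup\{(0,0)\}$, partitioning the $\bar z$-tuples of every $M\in\mathcal C$, with $|\sigma(M^r;\bar c)|=\lambda|M|^{e/N}+o(|M|^{e/N})$ uniformly on the cell $\chi_{e,\lambda}$. Fix such a partition. A positive integer $e$ is an essential selector dimension if for some $\lambda>0$ the structures $A\in\mathcal D$ with $\alpha(A)\models\chi_{e,\lambda}(\bar c_A)$ have unbounded cardinality. *)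

(* Defs.v *)
From HB Require Import structures.
From mathcomp Require Import all_boot all_order all_algebra.
From mathcomp Require Import all_classical all_reals all_analysis.

Set Implicit Arguments.
Unset Strict Implicit.
Unset Printing Implicit Defensive.

Import Order.TTheory GRing.Theory Num.Theory.
Local Open Scope ring_scope.

(* Countable relational languages with finitely many sorts; function and
   constant symbols are represented by their graphs. *)
Record language := Language {
  lsort : finType;
  lrel : countType;
  arity : lrel -> nat;
  argsort : forall Q : lrel, 'I_(arity Q) -> lsort }.

(* The universe is the disjoint union of all the sorts, so that #|M| is the
   total number of elements; sort_of tells the summands apart. *)
Record structure (L : language) := Structure {
  universe :> finType;
  sort_of : universe -> lsort L;
  interp : forall Q : lrel L, {set {ffun 'I_(arity Q) -> universe}};
  interp_sorted : forall (Q : lrel L) (t : {ffun 'I_(arity Q) -> universe}),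
    t \in interp Q -> forall i, sort_of (t i) = argsort i }.

Definition class_of_structures (L : language) := structure L -> Prop.

Record member (L : language) (C : class_of_structures L) := Member {
  str :> structure L;
  strP : C str }.

(* [formula L V]: first-order formulas with free variables in V. The variable
   bound by FEx is None. Variables range over the whole universe and FSort
   tests membership in a sort, so a quantifier over one sort is a relativized
   quantifier. *)
Inductive formula (L : language) (V : Type) : Type :=
| FFalse
| FEq of V & V
| FSort of lsort L & V
| FRel (Q : lrel L) of {ffun 'I_(arity Q) -> V}
| FNot of formula L V
| FAnd of formula L V & formula L V
| FEx of formula L (option V).

Arguments FFalse {L V}.

Fixpoint sat (L : language) (M : structure L) (V : Type) (f : formula L V) :
    (V -> M) -> bool :=
  match f with
  | FFalse => fun=> false
  | FEq x y => fun e => e x == e y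
  | FSort s x => fun e => sort_of (e x) == s
  | FRel Q t => fun e => [ffun i => e (t i)] \in interp M Q
  | FNot g => fun e => ~~ sat g e
  | FAnd g h => fun e => sat g e && sat h e
  | FEx g => fun e => [exists x : M, sat g (oapp e x)]
  end.

Definition join (V W T : Type) (e : V -> T) (f : W -> T) (x : V + W) : T :=
  match x with inl v => e v | inr w => f w end.

(* An m-tuple of r-tuples as an assignment of the variables 'I_m * 'I_r. *)
Definition flat (T : Type) (m r : nat) (w : 'I_m -> {ffun 'I_r -> T})
  (p : 'I_m * 'I_r) : T := w p.1 p.2.

(* The definable set phi(M^n; a). *)
Definition defset (L : language) (M : structure L) (n m : nat)
    (phi : formula L ('I_n + 'I_m)) (a : 'I_m -> M) :
    {set {ffun 'I_n -> M}} :=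
  [set b : {ffun 'I_n -> M} | sat phi (join b a)].

(* f = o(g) uniformly on the collection Phi of pairs (M, a). *)
Definition uniform_littleo (R : realType) (L : language) (m : nat)
    (Phi : forall M : structure L, {ffun 'I_m -> M} -> Prop)
    (f g : forall M : structure L, {ffun 'I_m -> M} -> R) : Prop :=
  forall eps : R, 0 < eps -> exists B : nat,
    forall (M : structure L) (a : {ffun 'I_m -> M}),
      Phi M a -> (B < #|M|)%N -> `|f M a| <= eps * g M a.

(* The finite set of pairs (d, mu) is given by the list D. For (0, 0) the
   asymptotic clause reads |phi(M^n; a)| = o(1), since x `^ 0 = 1 for all x. *)
Record definable_sizes (R : realType) (L : language) (N : nat)
    (C : class_of_structures L) (n m : nat) (phi : formula L ('I_n + 'I_m))
    (D : seq (nat * R)) (theta : nat * R -> formula L 'I_m) : Prop := {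
  sizes_range : forall p, p \in D ->
    ((p.1 <= N * n)%N /\ 0 < p.2) \/ p = (0%N, 0);
  sizes_partition : forall M : structure L, C M ->
    forall a : {ffun 'I_m -> M},
      exists! p : nat * R, p \in D /\ sat (theta p) a;
  sizes_asymptotics : forall p, p \in D ->
    uniform_littleo
      (fun M a => C M /\ sat (theta p) a)
      (fun M a => #|defset phi a|%:R
                  - p.2 * (#|M|%:R : R) `^ (p.1%:R / N%:R))
      (fun M _ => #|M|%:R `^ (p.1%:R / N%:R)) }.

Definition asymptotic_class (R : realType) (L : language) (N : nat)
    (C : class_of_structures L) : Prop :=
  (0 < N)%N /\
  forall (m : nat) (phi : formula L ('I_1 + 'I_m)),
    exists (D : seq (nat * R)) (theta : nat * R -> formula L 'I_m),
      definable_sizes N C phi D theta.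

Section Quotient.
Variables (L : language) (M : structure L) (r s : nat).
Variables (delta : formula L ('I_r + 'I_s)).
Variables (eps : formula L (('I_r + 'I_r) + 'I_s)) (c : {ffun 'I_s -> M}).

Definition def_rel : rel {ffun 'I_r -> M} :=
  fun u v => sat eps (join (join u v) c).

Definition def_quotient : {set {set {ffun 'I_r -> M}}} :=
  equivalence_partition def_rel (defset delta c).

End Quotient.

(* Uniform parameter-interpretation of D in C, of arity r, with s parameters.
   The sorts of L' are interpreted as unary relation symbols, and iso A maps
   a to its class, i.e. to the set of its representatives. *)
Record interpretation (L L' : language) (C : class_of_structures L)
    (D : class_of_structures L') (r s : nat) := Interpretation {
  arity_gt0 : (0 < r)%N;
  alpha : member D -> member C;
  alpha_inj : forall A B : member D,
    alpha A = alpha B :> structure L -> A = B :> structure L';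
  idom : formula L ('I_r + 'I_s);
  ieq : formula L (('I_r + 'I_r) + 'I_s);
  isort : lsort L' -> formula L ('I_r + 'I_s);
  irel : forall Q : lrel L', formula L ('I_(arity Q) * 'I_r + 'I_s);
  param : forall A : member D, {ffun 'I_s -> alpha A};
  iso : forall A : member D, A -> {set {ffun 'I_r -> alpha A}};
  ieq_equiv : forall A : member D,
    {in defset idom (param A) & &, equivalence_rel (def_rel ieq (param A))};
  isort_invariant : forall (A : member D) (k : lsort L'),
    {in defset idom (param A) &, forall u v, def_rel ieq (param A) u v ->
      sat (isort k) (join u (param A)) = sat (isort k) (join v (param A))};
  irel_invariant : forall (A : member D) (Q : lrel L')
      (u v : 'I_(arity Q) -> {ffun 'I_r -> alpha A}),
    (forall i, u i \in defset idom (param A)) ->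
    (forall i, v i \in defset idom (param A)) ->
    (forall i, def_rel ieq (param A) (u i) (v i)) ->
    sat (irel Q) (join (flat u) (param A))
      = sat (irel Q) (join (flat v) (param A));
  iso_inj : forall A : member D, injective (@iso A);
  iso_im : forall A : member D,
    [set iso a | a : A] = def_quotient idom ieq (param A);
  iso_sort : forall (A : member D) (k : lsort L') (a : A)
      (u : {ffun 'I_r -> alpha A}), u \in iso a ->
    (sort_of a == k) = sat (isort k) (join u (param A));
  iso_rel : forall (A : member D) (Q : lrel L') (a : {ffun 'I_(arity Q) -> A})
      (u : 'I_(arity Q) -> {ffun 'I_r -> alpha A}),
    (forall i, u i \in iso (a i)) ->
    (a \in interp A Q) = sat (irel Q) (join (flat u) (param A)) }.

Section Selectors.
Variables (L L' : language).
Variables (C : class_of_structures L) (D : class_of_structures L').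
Variables (r s : nat) (I : interpretation C D r s).
Variable sigma : formula L ('I_r + 'I_s).

(* is_transversal also requires that the E_A-classes partition X_A, which
   already follows from ieq_equiv. *)
Definition is_selector : Prop := forall A : member D,
  is_transversal (defset sigma (param I A))
    (def_quotient (idom I) (ieq I) (param I A)) (defset (idom I) (param I A)).

(* w i is the selected representative of a i. *)
Definition trace_reflecting : Prop :=
  forall (m : nat) (rho : formula L ('I_m * 'I_r + 'I_s)),
  exists rho' : formula L' 'I_m,
  forall (A : member D) (a : {ffun 'I_m -> A})
    (w : 'I_m -> {ffun 'I_r -> alpha I A}),
    (forall i, w i \in defset sigma (param I A) /\ w i \in iso I (a i)) ->
    sat rho' a <-> sat rho (join (flat w) (param I A)).

End Selectors.

Section EssentialDimensions.
Variables (R : realType) (L L' : language).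
Variables (C : class_of_structures L) (D : class_of_structures L').
Variables (r s : nat) (I : interpretation C D r s).
Variables (P : seq (nat * R)) (chi : nat * R -> formula L 'I_s).

Definition essential_dim (e : nat) : Prop :=
  (0 < e)%N /\ exists lambda : R,
    [/\ 0 < lambda, (e, lambda) \in P &
        forall B : nat, exists A : member D,
          sat (chi (e, lambda)) (param I A) /\ (B < #|A|)%N].

(* Every essential dimension is the first component of some p in P. *)
Definition selector_lcm : nat :=
  \big[lcmn/1%N]_(p <- P | `[< essential_dim p.1 >]) p.1.

End EssentialDimensions.

(* Main.v *)
(* Counting fibres over the cells of one variable at a time, the asymptotic
   clause for one object variable extends to definable sets in n variables.
   Through the selector, A is in bijection with the definable set S_A and a
   definable subset of A with a definable subset of S_A. On a cell where
   |S_A| ~ lambda |M|^(e/N) and the subset has size ~ mu |M|^(d/N), eliminating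
   |M| gives mu lambda^(-d/e) |A|^(d/e), unless |A| is bounded on the cell.
   Selector-trace reflection makes these cells definable in A. *)
Require Import Defs.
From mathcomp Require Import all_boot all_order all_algebra.
From mathcomp Require Import all_classical all_reals all_analysis.
From mathcomp Require Import ring lra.

Set Implicit Arguments.
Unset Strict Implicit.
Unset Printing Implicit Defensive.

Import Order.TTheory GRing.Theory Num.Theory.
Local Open Scope ring_scope.

(** The estimates of [C] are uniform for large |M|, while those of [D] must be uniform for large
    |A|. The bridge is |A| <= |M|^r, valid because A is counted by r-tuples of M: a large A forces a
    large M. The converse fails, so a cell may contain arbitrarily large M and only small A. On such
    a cell every pair is vacuously correct, since a uniform little-o looks only at large structures.
    The sharpened denominator exploits this. A selector exponent e has to divide the denominator K
    only in order to write d/e as d(K/e)/K, hence only when |A| is unbounded on some cell with that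
    exponent. The remaining obstructions, e = 0 and d > e with a positive coefficient, also force
    |A| to be bounded. Leading terms never cancel when cells are added up, because every nonzero
    coefficient is positive. *)

(** * Renaming of variables and quantification over tuples *)

Section Formulas.
Variable L : language.

Fixpoint rename (V : Type) (f : formula L V) : forall W, (V -> W) -> formula L W :=
  match f with
  | FFalse => fun W _ => FFalse
  | FEq x y => fun W g => FEq L (g x) (g y)
  | FSort k x => fun W g => FSort k (g x)
  | FRel Q t => fun W g => FRel [ffun i => g (t i)]
  | FNot f1 => fun W g => FNot (rename f1 g)
  | FAnd f1 f2 => fun W g => FAnd (rename f1 g) (rename f2 g)
  | FEx f1 => fun W g => FEx (rename f1 (omap g))
  end.

Lemma sat_rename (M : structure L) (V : Type) (f : formula L V) (W : Type)
  (g : V -> W) (e : W -> M) : sat (rename f g) e = sat f (e \o g).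
Proof.
elim: V / f W g e => //=.
- by move=> V Q t W g e; have -> : [ffun i => e ([ffun i0 => g (t i0)] i)] = [ffun i => (e \o g) (t i)]
    by apply/ffunP=> i; rewrite !ffunE.
- by move=> V f IH W g e; rewrite IH.
- by move=> V f IHf h IHh W g e; rewrite IHf IHh.
- move=> V f IH W g e; apply: eq_existsb => x; rewrite IH; congr (sat f _).
  by apply/funext; case.
Qed.

Definition FOr V (f g : formula L V) := FNot (FAnd (FNot f) (FNot g)).

Lemma sat_FOr (M : structure L) V (f g : formula L V) (e : V -> M) :
  sat (FOr f g) e = sat f e || sat g e.
Proof. by rewrite /= negb_and !negbK. Qed.

(** [None] is the variable bound by [FEx], so this prepares quantification over coordinate 0. The
    same map later singles out coordinate 0 as the object variable when a set of (n+1)-tuples is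
    fibred over n-tuples. *)
Definition pull_var n V (x : 'I_n.+1 + V) : option ('I_n + V) :=
  match x with
  | inl i => omap inl (unlift ord0 i)
  | inr v => Some (inr v)
  end.

Fixpoint FExs n V : formula L ('I_n + V) -> formula L V :=
  match n with
  | 0 => fun f => rename f (fun x => match x with
                            | inl i => False_rect V (Bool.diff_false_true (ltn_ord i))
                            | inr v => v end)
  | n.+1 => fun f => FExs (FEx (rename f (@pull_var n V)))
  end.
End Formulas.
Definition fcons (T : Type) n (x : T) (b : {ffun 'I_n -> T}) : {ffun 'I_n.+1 -> T} :=
  [ffun i => oapp b x (unlift ord0 i)].

Definition fbehead (T : Type) n (b : {ffun 'I_n.+1 -> T}) : {ffun 'I_n -> T} :=
  [ffun i => b (lift ord0 i)].

Lemma fbeheadK (T : Type) n (b : {ffun 'I_n.+1 -> T}) :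
  fcons (b ord0) (fbehead b) = b.
Proof.
by apply/ffunP=> i; rewrite ffunE; case: unliftP => [j|] -> //=; rewrite ffunE.
Qed.

Lemma fconsK (T : Type) n (x : T) : cancel (@fcons T n x) (@fbehead T n).
Proof. by move=> b; apply/ffunP=> i; rewrite !ffunE liftK. Qed.

Lemma join_fcons (T : Type) n V (x : T) (b : {ffun 'I_n -> T}) (e : V -> T) :
  oapp (join b e) x \o @pull_var n V = join (fcons x b) e.
Proof.
apply/funext; case=> [i|v] //=; rewrite ffunE.
by case: (unliftP ord0 i).
Qed.

Lemma sat_FExs L (M : structure L) n V (f : formula L ('I_n + V)) (e : V -> M) :
  sat (FExs f) e = [exists b : {ffun 'I_n -> M}, sat f (join b e)].
Proof.
elim: n f => [|n IH] f /=.
  rewrite sat_rename; set e' := (X in sat f X).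
  have Ee (b : {ffun 'I_0 -> M}) : join b e = e' by apply/funext; case=> [[]|].
  apply/idP/existsP => [h|[b]]; last by rewrite Ee.
  by exists [ffun i : 'I_0 => e' (inl i)]; rewrite Ee.
rewrite IH; apply/existsP/existsP => [[b]|[b]] /=.
  by move=> /existsP[x]; rewrite sat_rename join_fcons => h; exists (fcons x b).
move=> h; exists (fbehead b); apply/existsP; exists (b ord0).
by rewrite sat_rename join_fcons fbeheadK.
Qed.

(** * Calculus of leading terms *)

Section Asymptotics.
Variable R : realType.

(** The range allowed by [sizes_range], with K in place of N * n. A coefficient 0 forces the pair
    (0, 0), so case distinctions need to test only [p.2]. *)
Definition okpair (K : nat) (p : nat * R) : Prop :=
  ((p.1 <= K)%N /\ 0 < p.2) \/ p = (0%N, 0).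

Lemma okpair0 K p : okpair K p -> p.2 = 0 -> p = (0%N, 0).
Proof. by case=> // -[_ p0] p20; rewrite p20 ltxx in p0. Qed.

Lemma okpair_gt0 K p : okpair K p -> p.2 <> 0 -> (p.1 <= K)%N /\ 0 < p.2.
Proof. by case=> [//|-> /=]. Qed.

Definition rpow (N d x : nat) : R := x%:R `^ (d%:R / N%:R).

Lemma rpow_ge0 N d x : 0 <= rpow N d x. Proof. exact: powR_ge0. Qed.

Lemma rpow_gt0 N d x : (0 < x)%N -> 0 < rpow N d x.
Proof. by move=> x0; apply: powR_gt0; rewrite ltr0n. Qed.

Lemma rpow0 N x : rpow N 0 x = 1.
Proof. by rewrite /rpow mul0r powRr0. Qed.

Lemma rpowD N d e x : (0 < x)%N -> rpow N (d + e) x = rpow N d x * rpow N e x.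
Proof.
move=> x0; rewrite /rpow natrD mulrDl powRD //; apply/implyP => _.
by rewrite pnatr_eq0 -lt0n.
Qed.

Lemma rpow_ge1 N d x : (0 < x)%N -> 1 <= rpow N d x.
Proof.
move=> x0; rewrite -(rpow0 N x); apply: ler_powR.
  by rewrite ler1n.
by rewrite mul0r divr_ge0.
Qed.

Lemma rpow_littleo N d e (eps : R) : (0 < N)%N -> (d < e)%N -> 0 < eps ->
  exists B : nat, forall x, (B < x)%N -> rpow N d x <= eps * rpow N e x.
Proof.
move=> N0 de eps0.
(* For x > B this gives x^(1/N) >= eps^-1. One such factor is available because e >= d + 1, and the
   other factors are at least 1. *)
have [B hB] : exists B : nat, eps^-1 ^+ N <= B%:R.
  exists (Num.bound (eps^-1 ^+ N)); apply/ltW/archi_boundP.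
  by rewrite exprn_ge0 // invr_ge0 ltW.
exists B => x Bx; have x0 : (0 < x)%N by apply: leq_ltn_trans Bx.
rewrite -(subnK de) addnS -addSn rpowD // mulrA ler_peMl ?rpow_ge0 //.
rewrite -[_.+1]addn1 addnC rpowD // mulrA.
have h1 := rpow_ge1 N (e - d.+1) x0.
have h2 : eps^-1 <= rpow N 1 x.
  rewrite -(ler_pXn2r N0) ?nnegrE ?rpow_ge0 ?invr_ge0 ?(ltW eps0) //.
  have -> : rpow N 1 x ^+ N = x%:R.
    by rewrite -(powR_mulrn _ (rpow_ge0 _ _ _)) -powRrM mul1r mulVf ?powRr1 ?pnatr_eq0 -?lt0n.
  by apply: le_trans hB _; rewrite ler_nat ltnW.
rewrite -[leLHS]mulr1; apply: ler_pM => //.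
by rewrite -ler_pdivrMl // mulr1.
Qed.

Variable I : Type.

(** The index type and the gauge [X] are left free: the same notion measures sizes against |M|,
    against |A|, and over the points of a fibration. A pair (e, 0) with e > 0 is meaningful here,
    although not an [okpair]: it says that F = o(X^(e/N)). *)
Definition asymp (N : nat) (X : I -> nat) (Phi : I -> Prop) (F : I -> R)
    (p : nat * R) : Prop :=
  forall eps, 0 < eps -> exists B : nat, forall i, Phi i -> (B < X i)%N ->
    `|F i - p.2 * rpow N p.1 (X i)| <= eps * rpow N p.1 (X i).

Implicit Types (X : I -> nat) (Phi : I -> Prop) (F G : I -> R) (p q : nat * R).

Lemma asymp_sub N X Phi Psi F p : (forall i, Psi i -> Phi i) ->
  asymp N X Phi F p -> asymp N X Psi F p.
Proof.
by move=> sub as_ eps /as_[B hB]; exists B => i /sub; apply: hB.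
Qed.

Lemma asymp_bounded N X Phi F p B : (forall i, Phi i -> (X i <= B)%N) ->
  asymp N X Phi F p.
Proof.
by move=> h eps _; exists B => i /h le lt; have := leq_ltn_trans le lt; rewrite ltnn.
Qed.

Lemma asymp_eq N X Phi F G p : (forall i, Phi i -> F i = G i) ->
  asymp N X Phi F p -> asymp N X Phi G p.
Proof.
move=> FG as_ eps /as_[B hB]; exists B => i Pi; rewrite -FG //; exact: hB.
Qed.

(** A natural number at most 1/2 is 0, so o(1) means exactly empty beyond a threshold. *)
Lemma asymp_nat0 N X Phi (F : I -> nat) (p := (0%N, 0)) :
  asymp N X Phi (fun i => (F i)%:R) p ->
  exists B : nat, forall i, Phi i -> (B < X i)%N -> F i = 0%N.
Proof.
move=> /(_ (1/2)) [|B hB]; first by lra.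
exists B => i Pi Bx; have := hB i Pi Bx.
rewrite /= mul0r subr0 rpow0 mulr1 normr_nat => h.
case: (posnP (F i)) => // F0; suff h1 : (1 : R) <= 1 / 2 by exfalso; lra.
by apply: le_trans h; rewrite ler1n.
Qed.

Lemma asymp0 N X Phi F B :
  (forall i, Phi i -> (B < X i)%N -> F i = 0) ->
  asymp N X Phi F (0%N, 0).
Proof.
move=> h eps eps0; exists B => i Pi Bx; rewrite h // mul0r subrr normr0.
by rewrite mulr_ge0 ?rpow_ge0 ?ltW.
Qed.

Lemma asymp_littleo N X Phi F p e : (0 < N)%N -> (p.1 < e)%N ->
  asymp N X Phi F p -> asymp N X Phi F (e, 0).
Proof.
move=> N0 pe as_ eps eps0.
have [B1 h1] := as_ 1 ltr01.
(* Beyond [B1], |F| is at most |p.2| + 1 times its own power of X, the 1 being the tolerance used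
   for [h1]. *)
have [|B2 h2] := @rpow_littleo N p.1 e (eps / (`|p.2| + 1)) N0 pe.
  by rewrite divr_gt0 // ltr_wpDl.
exists (maxn B1 B2) => i Pi; rewrite gtn_max => /andP[/(h1 _ Pi) {}h1 /h2 {}h2] /=.
rewrite mul0r subr0.
have /le_trans : `|F i| <= (`|p.2| + 1) * rpow N p.1 (X i).
  rewrite -{1}(subrK (p.2 * rpow N p.1 (X i)) (F i)).
  apply: le_trans (ler_normD _ _) _.
  by rewrite normrM (ger0_norm (rpow_ge0 _ _ _)) mulrDl addrC; apply: lerD.
apply; apply: le_trans (ler_wpM2l _ h2) _; first by rewrite addr_ge0.
by rewrite mulrA mulrCA divff ?mulr1 // gt_eqF // ltr_wpDl.
Qed.

Lemma asympD N X Phi F G d mu nu :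
  asymp N X Phi F (d, mu) -> asymp N X Phi G (d, nu) ->
  asymp N X Phi (fun i => F i + G i) (d, mu + nu).
Proof.
move=> aF aG eps eps0; have e2 : 0 < eps / 2 by lra.
have [B1 h1] := aF _ e2; have [B2 h2] := aG _ e2.
exists (maxn B1 B2) => i Pi; rewrite gtn_max => /andP[/(h1 _ Pi) {}h1 /(h2 _ Pi) {}h2] /=.
rewrite mulrDl opprD addrACA; apply: le_trans (ler_normD _ _) _.
by apply: le_trans (lerD h1 h2) _; rewrite -mulrDl /= -splitr.
Qed.

Lemma asymp_o1 N X Phi F e : (0 < N)%N ->
  asymp N X Phi F (0%N, 0) -> asymp N X Phi F (e, 0).
Proof.
by case: e => // e N0; apply: asymp_littleo.
Qed.

Definition sum_pair p q : nat * R :=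
  if p.2 == 0 then q else if q.2 == 0 then p else
  if (p.1 < q.1)%N then q else if (q.1 < p.1)%N then p else (p.1, p.2 + q.2).


Lemma okpair_sum_pair K p q : okpair K p -> okpair K q -> okpair K (sum_pair p q).
Proof.
rewrite /sum_pair; case: eqP => [//|p0] okp; case: eqP => [//|q0] okq.
case: ltngtP => //= _; left => /=.
case: okp okq p0 q0 => [[le1 p1]|->] // [[_ q1]|->] //= _ _.
by split=> //; rewrite addr_gt0.
Qed.

(** The weaker summand is restated with the exponent of the stronger one and coefficient 0, so every
    case reduces to [asympD] at a common exponent. *)
Lemma asymp_sum_pair K N X Phi F G p q : (0 < N)%N -> okpair K p -> okpair K q ->
  asymp N X Phi F p -> asymp N X Phi G q ->
  asymp N X Phi (fun i => F i + G i) (sum_pair p q).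
Proof.
move=> N0; rewrite /sum_pair => okp okq aF aG; case: eqP => [/(okpair0 okp) p0|_].
  rewrite {}p0 in aF; case: q {okq} aG => d mu aG.
  by rewrite -[mu]add0r; apply: asympD => //; apply: asymp_o1.
case: eqP => [/(okpair0 okq) q0|_].
  rewrite {}q0 in aG; case: p {okp} aF => d mu aF.
  by rewrite -[mu]addr0; apply: asympD => //; apply: asymp_o1.
case: p q aF aG {okp okq} => [d mu] [e nu] aF aG /=.
case: ltngtP => [de|ed|de].
- by rewrite -[nu]add0r; apply: asympD => //; apply: asymp_littleo aF.
- by rewrite -[mu]addr0; apply: asympD => //; apply: asymp_littleo aG.
- by rewrite -de in aG; apply: asympD.
Qed.

(** A zero factor resets the exponent to 0, since [okpair] admits the coefficient 0 only there. *)
Definition prod_pair p q : nat * R :=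
  if (p.2 == 0) || (q.2 == 0) then (0%N, 0) else ((p.1 + q.1)%N, p.2 * q.2).

Lemma okpair_prod_pair K H p q : okpair K p -> okpair H q ->
  okpair (K + H) (prod_pair p q).
Proof.
rewrite /prod_pair; case: ifP => [|/norP[p0 q0]]; first by right.
case=> [[lep p1]|e]; last by rewrite e eqxx in p0.
case=> [[leq q1]|e]; last by rewrite e eqxx in q0.
by left; rewrite leq_add // mulr_gt0.
Qed.

End Asymptotics.

(** The hypothesis on fibres is indexed by pairs (i, x), so one threshold serves all fibres over i
    at once and their errors can be summed over the base. *)
Lemma asymp_fibre (R : realType) (I : Type) (K H N : nat) (X : I -> nat)
    (T : I -> finType) (Phi : I -> Prop) (S : forall i, {set T i})
    (G : forall i, T i -> nat) (p q : nat * R) :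
  okpair K p -> okpair H q ->
  asymp N X Phi (fun i => #|S i|%:R) p ->
  asymp N (fun j : {i & T i} => X (tag j))
    (fun j => Phi (tag j) /\ tagged j \in S (tag j))
    (fun j => (G _ (tagged j))%:R) q ->
  asymp N X Phi (fun i => (\sum_(x in S i) G i x)%:R) (prod_pair p q).
Proof.
rewrite /prod_pair => okp okq aS aG; case: eqP => [/(okpair0 okp) p0|] /=.
  rewrite {}p0 in aS; have [B hB] := asymp_nat0 aS; apply: (@asymp0 _ _ _ _ _ _ B) => i Pi Bi.
  by rewrite (cards0_eq (hB i Pi Bi)) big_set0.
move=> /(okpair_gt0 okp)[_ nu0].
case: eqP => [/(okpair0 okq) q0|/(okpair_gt0 okq)[_ mu0]] /=.
  rewrite {}q0 in aG; have [B hB] := asymp_nat0 aG; apply: (@asymp0 _ _ _ _ _ _ B) => i Pi Bi.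
  by rewrite big1 // => x Sx; apply: (hB (existT _ i x)).
case: p q nu0 mu0 {okp okq} aS aG => [k nu] [d mu] /= nu0 mu0 aS aG.
move=> eps eps0.
(* The bound 1 gives at most (nu + 1) tk fibres; the other bound keeps the error in the number of
   fibres, multiplied by mu, below half of eps. *)
have [|B1 h1] := aS (Num.min 1 (eps / 2 / mu)).
  by rewrite lt_min ltr01 !divr_gt0.
have [|B2 h2] := aG (eps / 2 / (nu + 1)); first by rewrite !divr_gt0 // addr_gt0.
exists (maxn B1 B2) => i Pi; rewrite gtn_max => /andP[Bi Bi2] /=.
have x0 : (0 < X i)%N by apply: leq_ltn_trans Bi.
rewrite rpowD //; set tk := rpow R N k _; set td := rpow R N d _.
have tk0 : 0 <= tk by apply: rpow_ge0.
have td0 : 0 <= td by apply: rpow_ge0.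
have {h1} := h1 i Pi Bi; rewrite /= -/tk => h1.
have hS1 : `|#|S i|%:R - nu * tk| <= tk.
  by apply: le_trans h1 _; rewrite ler_piMl // ge_min lexx.
have hS2 : `|#|S i|%:R - nu * tk| * mu <= eps / 2 * tk.
  rewrite -ler_pdivlMr // mulrAC; apply: le_trans h1 _.
  by rewrite ler_wpM2r // ge_min lexx orbT.
have hS3 : #|S i|%:R <= (nu + 1) * tk.
  rewrite mulrDl mul1r -lerBlDl; apply: le_trans hS1; exact: ler_norm.
(* The error splits into the errors inside the fibres and the error of the base weighted by the
   typical fibre size mu td. *)
have -> : (\sum_(x in S i) G i x)%:R - nu * mu * (tk * td)
  = \sum_(x in S i) ((G i x)%:R - mu * td) + (#|S i|%:R - nu * tk) * mu * td.
  rewrite big_split /= natr_sum sumrN sumr_const -mulr_natl; ring.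
apply: le_trans (ler_normD _ _) _.
have -> : eps * (tk * td) = eps / 2 * tk * td + eps / 2 * tk * td by field.
apply: lerD; last first.
  by rewrite !normrM (ger0_norm td0) (gtr0_norm mu0) ler_wpM2r.
apply: le_trans (ler_norm_sum _ _ _) _.
apply: (@le_trans _ _ (\sum_(x in S i) (eps / 2 / (nu + 1) * td))).
  by apply: ler_sum => x Sx; apply: (h2 (existT _ i x)).
rewrite sumr_const -[leLHS]mulr_natl mulrA ler_wpM2r // mulrC.
apply: le_trans (ler_wpM2l _ hS3) _; first by rewrite !divr_ge0 ?addr_ge0 ?ltW.
by rewrite mulrA divfK ?lexx // gt_eqF // addr_gt0.
Qed.

(** For an exponent in [0, 1], q^a lies between 1 and q. *)
Lemma powR_sub1_le (R : realType) (q a : R) : 0 < q -> 0 <= a <= 1 ->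
  `|q `^ a - 1| <= `|q - 1|.
Proof.
move=> q0 /andP[a0 a1]; have [q1|q1] := leP 1 q.
  have h1 : 1 <= q `^ a by rewrite -(powRr0 q) ler_powR.
  have h2 : q `^ a <= q by rewrite -[leRHS](powRr1 (ltW q0)) ler_powR.
  by rewrite !ger0_norm ?subr_ge0 // lerB.
have q01 : 0 < q <= 1 by rewrite q0 ltW.
have h1 : q `^ a <= 1 by rewrite -(powRr0 q) ger_powR.
have h2 : q <= q `^ a by rewrite -[leLHS](powRr1 (ltW q0)) ger_powR.
rewrite !ler0_norm ?subr_le0 //; last exact: ltW.
by rewrite !opprB lerB.
Qed.

(** * Change of gauge from X to Y, to be used with X = |M| and Y = |A| *)

Section Transfer.
Variables (R : realType) (I : Type) (N r : nat) (X Y : I -> nat).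
Variables (Phi : I -> Prop) (F : I -> R).
Hypothesis r_gt0 : (0 < r)%N.
Hypothesis leYX : forall i, Phi i -> (Y i <= X i ^ r)%N.

Lemma gt_transfer B i : Phi i -> (B ^ r < Y i)%N -> (B < X i)%N.
Proof.
by move=> Pi By; rewrite -(ltn_exp2r _ _ r_gt0); apply: leq_trans By (leYX Pi).
Qed.

Lemma asymp_transfer0 K :
  asymp N X Phi F (0%N, 0) -> asymp K Y Phi F (0%N, 0).
Proof.
move=> aF eps /aF[B hB]; exists (B ^ r)%N => i Pi /(gt_transfer Pi) Bi.
by have := hB i Pi Bi; rewrite !rpow0.
Qed.

Lemma transfer_bounded0 (lam : R) :
  asymp N X Phi (fun i => (Y i)%:R) (0%N, lam) ->
  exists B : nat, forall i, Phi i -> (Y i <= B)%N.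
Proof.
move=> /(_ 1 ltr01)[B hB].
exists (maxn (B ^ r) (Num.bound (`|lam| + 1))) => i Pi; rewrite leqNgt gtn_max.
apply/negP => /andP[/(gt_transfer Pi) Bi].
have := hB i Pi Bi; rewrite /= rpow0 !mulr1 => h.
rewrite -(ltr_nat R); apply/negP; rewrite -leNgt.
apply: (@le_trans _ _ (`|lam| + 1)); last first.
  by apply/ltW/archi_boundP; rewrite addr_ge0.
rewrite ler_distl in h; case/andP: h => _ /le_trans; apply.
by rewrite lerD2r ler_norm.
Qed.

(** For large X, F would be at least 2/3 of mu X^(d/N) and Y at most 1/3 of it, against F <= Y. So X
    is bounded on the cell, and with it Y. *)
Lemma transfer_bounded_lt d e (mu lam : R) : (0 < N)%N -> (e < d)%N -> 0 < mu ->
  (forall i, Phi i -> F i <= (Y i)%:R) ->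
  asymp N X Phi F (d, mu) -> asymp N X Phi (fun i => (Y i)%:R) (e, lam) ->
  exists B : nat, forall i, Phi i -> (Y i <= B)%N.
Proof.
move=> N0 ed mu0 FY aF aY.
have aY0 := @asymp_littleo _ _ _ _ _ _ (e, lam) d N0 ed aY.
have mu3 : 0 < mu / 3 by rewrite divr_gt0.
have [B1 h1] := aF _ mu3; have [B2 h2] := aY0 _ mu3.
exists (maxn B1 B2 ^ r)%N => i Pi; rewrite leqNgt; apply/negP => /(gt_transfer Pi).
rewrite gtn_max => /andP[Bi1 Bi2].
have := h1 i Pi Bi1; have := h2 i Pi Bi2; have := FY i Pi.
have : 0 < rpow R N d (X i) by apply: rpow_gt0; apply: leq_ltn_trans Bi1.
rewrite !ler_distl /=; set t := rpow _ _ _ _; set y := (Y i)%:R; set f := F i.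
move=> t0 fy /andP[_ a] /andP[b _].
have : 0 < mu * t by rewrite mulr_gt0.
by lra.
Qed.

(** With q = Y / (lam X^(e/N)) close to 1 and a = d/e, Y^a equals lam^a X^(d/N) q^a. The condition d
    <= e puts a in [0, 1], so q^a is at least as close to 1 as q. *)
Lemma asymp_transfer K d e (mu lam : R) :
  (0 < N)%N -> (0 < K)%N -> (0 < e)%N -> (e %| K)%N -> (d <= e)%N ->
  0 < mu -> 0 < lam ->
  asymp N X Phi (fun i => (Y i)%:R) (e, lam) -> asymp N X Phi F (d, mu) ->
  asymp K Y Phi F ((d * (K %/ e))%N, mu / lam `^ (d%:R / e%:R)).
Proof.
move=> N0 K0 e0 eK de mu0 lam0 aY aF eps eps0 /=.
set a := d%:R / e%:R : R; set la := lam `^ a.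
have la0 : 0 < la by apply: powR_gt0.
have rpowY y : rpow R K (d * (K %/ e)) y = y%:R `^ a.
  rewrite /rpow; congr (_ `^ _); rewrite /a -{2}(divnK eK) !natrM invfM.
  have q0 : (K %/ e)%:R != 0 :> R by rewrite pnatr_eq0 -lt0n divn_gt0 // dvdn_leq.
  have e1 : e%:R != 0 :> R by rewrite pnatr_eq0 -lt0n.
  by field; rewrite q0 e1.
have rpowX x : rpow R N e x `^ a = rpow R N d x.
  rewrite /rpow -powRrM; congr (_ `^ _); rewrite /a.
  have N1 : N%:R != 0 :> R by rewrite pnatr_eq0 -lt0n.
  have e1 : e%:R != 0 :> R by rewrite pnatr_eq0 -lt0n.
  by field; rewrite N1 e1.
have a01 : 0 <= a <= 1.
  by rewrite divr_ge0 //= ler_pdivrMr ?ltr0n // mul1r ler_nat.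
(* Two errors of at most c X^(d/N) arise below, and they are compared with Y^a, of which only the
   lower bound la X^(d/N) / 2 is used; hence the 4. *)
set c := eps * la / 4.
have c0 : 0 < c by rewrite !(divr_gt0, mulr_gt0).
have [B1 h1] := aF c c0.
(* After division by lam X^(e/N), the two bounds read |q - 1| <= 1/2 and mu |q - 1| <= c. *)
have [|B2 h2] := aY (Num.min (lam / 2) (c / mu * lam)).
  by rewrite lt_min !(divr_gt0, mulr_gt0).
exists (maxn B1 B2 ^ r)%N => i Pi /(gt_transfer Pi); rewrite gtn_max => /andP[Bi1 Bi2].
rewrite rpowY; have x0 : (0 < X i)%N by apply: leq_ltn_trans Bi1.
have {h1} h1 := h1 i Pi Bi1; have {h2} h2 := h2 i Pi Bi2.
rewrite /= in h1 h2.
have t0 : 0 < rpow R N e (X i) by apply: rpow_gt0.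
have td0 : 0 < rpow R N d (X i) by apply: rpow_gt0.
set t := rpow R N e (X i) in h2 t0; set td := rpow R N d (X i) in h1 td0.
pose q := (Y i)%:R / (lam * t).
have EY : (Y i)%:R = lam * t * q by rewrite /q mulrC divfK // mulf_neq0 // gt_eqF.
have Eq1 : `|q - 1| = `|(Y i)%:R - lam * t| / (lam * t).
  rewrite -{2}(gtr0_norm (mulr_gt0 lam0 t0)) -normrV ?unitfE ?mulf_neq0 ?gt_eqF //.
  by rewrite -normrM mulrBl divff // mulf_neq0 // gt_eqF.
have hq1 : `|q - 1| <= 1 / 2.
  rewrite Eq1 ler_pdivrMr ?mulr_gt0 //; apply: le_trans h2 _.
  have -> : 1 / 2 * (lam * t) = lam / 2 * t by field.
  by rewrite ler_wpM2r ?ge_min ?lexx // ltW.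
have hq2 : mu * `|q - 1| <= c.
  rewrite Eq1 mulrA ler_pdivrMr ?mulr_gt0 // mulrC -ler_pdivlMr //.
  apply: le_trans h2 _.
  have -> : c * (lam * t) / mu = c / mu * lam * t by field; rewrite gt_eqF.
  by rewrite ler_wpM2r ?ge_min ?lexx ?orbT // ltW.
have q0 : 0 < q by move: hq1; rewrite ler_distl => /andP[+ _]; lra.
have hqa := powR_sub1_le q0 a01.
have qa2 : 1 / 2 <= q `^ a.
  by move: (le_trans hqa hq1); rewrite ler_distl => /andP[+ _]; lra.
have -> : (Y i)%:R `^ a = la * td * q `^ a.
  rewrite EY powRM ?(ltW q0) ?mulr_ge0 ?(ltW lam0) ?(ltW t0) //.
  by rewrite powRM ?(ltW lam0) ?(ltW t0) // rpowX.
have -> : F i - mu / la * (la * td * q `^ a)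
  = (F i - mu * td) - mu * (q `^ a - 1) * td by field; rewrite gt_eqF.
apply: le_trans (ler_normB _ _) _.
rewrite !normrM (gtr0_norm mu0) (gtr0_norm td0).
apply: (@le_trans _ _ (c * td + c * td)).
  apply: lerD => //; rewrite ler_wpM2r ?(ltW td0) //; apply: le_trans hq2.
  by rewrite ler_wpM2l ?(ltW mu0).
have -> : c * td + c * td = eps * (la * td * (1 / 2)) by rewrite /c; field.
by rewrite ler_wpM2l ?(ltW eps0) // ler_wpM2l // mulr_ge0 ?(ltW la0) ?(ltW td0).
Qed.

End Transfer.

(* [defset] with an arbitrary type of parameter variables. *)
Definition solset (L : language) (M : structure L) n (W : Type)
    (phi : formula L ('I_n + W)) (e : W -> M) : {set {ffun 'I_n -> M}} :=
  [set b : {ffun 'I_n -> M} | sat phi (join b e)].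

Lemma in_solset (L : language) (M : structure L) n (W : Type)
    (phi : formula L ('I_n + W)) (e : W -> M) b :
  (b \in solset phi e) = sat phi (join b e).
Proof. by rewrite inE. Qed.

Lemma asymp_map (R : realType) (I J : Type) (f : J -> I) N (X : I -> nat)
    (Phi : I -> Prop) (F : I -> R) p :
  asymp N X Phi F p -> asymp N (X \o f) (Phi \o f) (F \o f) p.
Proof. by move=> as_ eps /as_[B hB]; exists B => j; apply: hB. Qed.

(** * Sizes of definable sets of n-tuples in [C] *)

Section Cells.
Variables (R : realType) (L : language) (N : nat) (C : class_of_structures L).

(** [F] is any numerical function, not only the size of a definable set, so that the partial sums of
    a fibre count are covered too. *)
Definition is_cells (W : Type) (K : nat)
    (F : forall M : structure L, (W -> M) -> nat) (T : finType)
    (p : T -> nat * R) (theta : T -> formula L W) : Prop :=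
  [/\ forall t, okpair K (p t),
      forall M, C M -> forall e : W -> M, exists t, sat (theta t) e
    & forall t, asymp N (fun i : {M : structure L & W -> M} => #|tag i|)
        (fun i => C (tag i) /\ sat (theta t) (tagged i))
        (fun i => (F _ (tagged i))%:R) (p t)].

(* The cells are only required to cover the assignments: overlaps are removed
   by [first_cell] below. *)
Definition sized (W : Type) (K : nat)
    (F : forall M : structure L, (W -> M) -> nat) : Prop :=
  exists (T : finType) (p : T -> nat * R) (theta : T -> formula L W),
    is_cells K F p theta.

Lemma sized_eq (W : Type) K (F G : forall M : structure L, (W -> M) -> nat) :
  (forall M, C M -> forall e : W -> M, F M e = G M e) -> sized K F -> sized K G.
Proof.
move=> FG [T [p [theta [ok cov as_]]]]; exists T, p, theta; split=> // t.
by apply: asymp_eq (as_ t) => -[M e] /= [CM _]; rewrite FG.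
Qed.

Lemma sized0 (W : Type) K : sized K (fun M (_ : W -> M) => 0%N).
Proof.
exists unit, (fun=> (0%N, 0)), (fun=> FNot FFalse); split=> [_||_].
- by right.
- by move=> M _ e; exists tt.
- exact: (@asymp0 _ _ _ _ _ _ 0).
Qed.

Hypothesis N_gt0 : (0 < N)%N.

Lemma sizedD (W : Type) K (F G : forall M : structure L, (W -> M) -> nat) :
  sized K F -> sized K G -> sized K (fun M e => F M e + G M e)%N.
Proof.
move=> [T [p [theta [okp covp asp]]]] [U [q [eta [okq covq asq]]]].
exists (T * U)%type, (fun x => sum_pair (p x.1) (q x.2)),
  (fun x => FAnd (theta x.1) (eta x.2)); split.
- by move=> x; apply: okpair_sum_pair.
- move=> M CM e; have [t ht] := covp M CM e; have [u hu] := covq M CM e.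
  by exists (t, u); rewrite /= ht hu.
- case=> t u /=.
  apply: (@asymp_eq _ _ _ _ _ (fun i : {M : structure L & W -> M} =>
    (F _ (tagged i))%:R + (G _ (tagged i))%:R)).
    by move=> i _; rewrite natrD.
  apply: (asymp_sum_pair N_gt0 (okp t) (okq u)).
    by apply: asymp_sub (asp t) => i [? /andP[]].
  by apply: asymp_sub (asq u) => i [? /andP[]].
Qed.

Lemma sized_sum (W : Type) (T : finType) K
    (F : T -> forall M : structure L, (W -> M) -> nat) :
  (forall t, sized K (F t)) -> sized K (fun M e => \sum_t F t M e)%N.
Proof.
move=> sF.
elim: (index_enum T) => [|t s IH].
  by apply: sized_eq (sized0 W K) => M _ e; rewrite big_nil.
by apply: sized_eq (sizedD (sF t) IH) => M _ e; rewrite big_cons.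
Qed.

(** All fibres share the single pair [p], so the cells of the base already serve for the total. *)
Lemma sized_fibre (W : Type) (T : structure L -> finType) K H (p : nat * R)
    (S : forall M : structure L, (W -> M) -> {set T M})
    (G : forall M : structure L, (W -> M) -> T M -> nat) :
  okpair H p ->
  sized K (fun M e => #|S M e|) ->
  asymp N (fun j : {i : {M : structure L & W -> M} & T (tag i)} => #|tag (tag j)|)
    (fun j => C (tag (tag j)) /\ tagged j \in S _ (tagged (tag j)))
    (fun j => (G _ (tagged (tag j)) (tagged j))%:R) p ->
  sized (K + H) (fun M e => \sum_(x in S M e) G M e x)%N.
Proof.
move=> okp [U [q [theta [okq cov as_]]]] aG.
exists U, (fun u => prod_pair (q u) p), theta; split => // u.
  exact: okpair_prod_pair.
apply: (asymp_fibre (okq u) okp (as_ u)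
  (G := fun i : {M : structure L & W -> M} => G (tag i) (tagged i))).
by apply: asymp_sub aG => j [[CM _] Sj].
Qed.

Lemma definable_sizes_cells n m (phi : formula L ('I_n + 'I_m)) D theta :
  definable_sizes N C phi D theta ->
  is_cells (N * n) (fun M (e : 'I_m -> M) => #|solset phi e|)
    (fun t : seq_sub D => ssval t) (fun t => theta (ssval t)).
Proof.
have fE (M : structure L) (e : 'I_m -> M) : [ffun i => e i] = e :> (_ -> _).
  by apply/funext=> i; rewrite ffunE.
case=> rng part as_; split.
- by move=> t; apply: rng; apply: ssvalP.
- move=> M CM e; have [p [[pD]]] := part M CM [ffun i => e i].
  by rewrite fE => sp _; exists (SeqSub pD).
- move=> t eps eps0; have [B hB] := as_ _ (ssvalP t) _ eps0.
  exists B => -[M e] /= [CM se] BM; have := hB M [ffun i => e i].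
  by rewrite fE; apply.
Qed.

(** Disjointness of the cells, which [is_cells] forgets, is retained here: it ensures that summing
    over the cells counts each fibre once. Parameters range over any finite type because the
    induction on dimension moves object variables among them. *)
Lemma asymptotic_class_cells (W : finType) (phi : formula L ('I_1 + W)) :
  asymptotic_class R N C ->
  exists (T : finType) (p : T -> nat * R) (theta : T -> formula L W),
    is_cells N (fun M (e : W -> M) => #|solset phi e|) p theta /\
    forall M, C M -> forall (e : W -> M) t u,
      sat (theta t) e -> sat (theta u) e -> t = u.
Proof.
case=> _ /(_ #|W| (rename phi (fun x => match x with
  | inl i => inl i | inr w => inr (enum_rank w) end))).
set psi := rename _ _ => -[D [theta ds]].
have [ok cov as_] := definable_sizes_cells ds.
have psiE (M : structure L) (e : W -> M) : solset psi (e \o enum_val) = solset phi e.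
  apply/setP=> b; rewrite !in_solset sat_rename; congr (sat phi _).
  by apply/funext; case=> //= w; rewrite enum_rankK.
exists (seq_sub D), (fun t => ssval t), (fun t => rename (theta (ssval t)) enum_val).
split; first split.
- by rewrite -[N]muln1.
- move=> M CM e; have [t ht] := cov M CM (e \o enum_val); exists t.
  by rewrite sat_rename.
- move=> t.
  have := asymp_map (fun i : {M : structure L & W -> M} =>
    existT (fun M : structure L => _ -> M) (tag i) (tagged i \o enum_val)) (as_ t).
  move=> h eps /h[B hB]; exists B => -[M e] /= [CM]; rewrite sat_rename => se.
  by move=> BM; have := hB (existT _ M e) (conj CM se) BM; rewrite /= psiE.
- move=> M CM e t u; rewrite !sat_rename.
  have [p [_ up]] := sizes_partition ds CM [ffun i => e (enum_val i)].
  have fE : [ffun i => e (enum_val i)] = e \o enum_val :> ('I_#|W| -> M).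
    by apply/funext=> i; rewrite ffunE.
  rewrite fE in up => ht hu; apply/val_inj => /=.
  by rewrite -(up (ssval t)) ?(up (ssval u)) //; split=> //; apply: ssvalP.
Qed.

Lemma card_solset_fcons n W (phi : formula L ('I_n.+1 + W)) (M : structure L)
    (e : W -> M)
    (psi := rename phi (fun x => oapp inr (inl ord0) (pull_var x))
      : formula L ('I_1 + ('I_n + W))) :
  #|solset phi e| = (\sum_(b : {ffun 'I_n -> M}) #|solset psi (join b e)|)%N.
Proof.
rewrite -sum1_card (partition_big (@fbehead M n) xpredT) //=.
apply: eq_bigr => b _.
have fcons_inj : injective (fun c : {ffun 'I_1 -> M} => fcons (c ord0) b).
  move=> c c' /ffunP/(_ ord0); rewrite !ffunE unlift_none /= => cc'.
  by apply/ffunP=> i; rewrite (ord1 i).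
have psiE (c : {ffun 'I_1 -> M}) :
    sat psi (join c (join b e)) = sat phi (join (fcons (c ord0) b) e).
  rewrite sat_rename -join_fcons; congr (sat phi _); apply/funext => y /=.
  by case: (pull_var y).
rewrite -(card_imset _ fcons_inj) -sum1_card; apply: eq_bigl => x.
apply/andP/imsetP => [[sx /eqP xb]|[c]].
  exists [ffun=> x ord0]; last by rewrite ffunE -xb fbeheadK.
  by rewrite in_solset psiE ffunE -xb fbeheadK -in_solset.
by rewrite in_solset psiE => sc ->; rewrite in_solset fconsK.
Qed.

Lemma sized_solset n (W : finType) (phi : formula L ('I_n + W)) :
  asymptotic_class R N C ->
  sized (N * n) (fun M (e : W -> M) => #|solset phi e|).
Proof.
move=> aC; elim: n W phi => [|n IH] W phi.
  have [f0 f0E] : exists f0, forall (M : structure L) (e : W -> M),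
      sat f0 e = [exists b : {ffun 'I_0 -> M}, sat phi (join b e)].
    by exists (FExs phi) => M e; exact: sat_FExs.
  (* There is only one 0-tuple, so the size is exactly the truth value of [f0]. *)
  exists bool, (fun t : bool => (0%N, t%:R)),
    (fun t => if t then f0 else FNot f0); split.
  - by case; [left | right].
  - move=> M _ e; case E : (sat f0 e); first by exists true.
    by exists false; rewrite /= E.
  - move=> t eps eps0; exists 0%N => -[M e] /= [_ st] _.
    suff -> : #|solset phi e| = t by rewrite rpow0 mulr1 subrr normr0 mulr1 ltW.
    have : (#|solset phi e| <= 1)%N.
      by apply: leq_trans (max_card _) _; rewrite card_ffun card_ord.
    case: t st => /=; rewrite f0E.
      move=> /existsP[b sb] le1; apply/eqP; rewrite eqn_leq le1 /=.
      by apply/card_gt0P; exists b; rewrite in_solset.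
    move=> /existsPn nb _; apply: eq_card0 => b.
    by rewrite in_solset; apply/negbTE/nb.
pose psi : formula L ('I_1 + ('I_n + W)) :=
  rename phi (fun x => oapp inr (inl ord0) (pull_var x)).
have [T [p [theta [[okp cov as_] uniq_t]]]] := asymptotic_class_cells psi aC.
rewrite mulnS addnC.
(* The contribution of the n-tuples in cell t: the induction hypothesis measures this base, and
   every fibre over it has the pair [p t]. *)
pose F t (M : structure L) (e : W -> M) :=
  (\sum_(b in solset (theta t) e) #|solset psi (join b e)|)%N.
apply: (@sized_eq _ _ (fun M e => \sum_t F t M e)%N) => [M CM e|].
  rewrite card_solset_fcons -/psi /F (exchange_big_dep xpredT) //=.
  apply: eq_bigr => b _; have [t ht] := cov M CM (join b e).
  rewrite (big_pred1 t) // => u /=; rewrite in_solset.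
  by apply/idP/eqP => [hu|-> //]; apply: uniq_t hu ht.
apply: sized_sum => t.
apply: (@sized_fibre W (fun M => {ffun 'I_n -> M}) _ _ (p t)
  (fun M e => solset (theta t) e) (fun M e b => #|solset psi (join b e)|)) => //.
move=> eps /(as_ t)[B hB]; exists B => -[[M e] b] /= [CM].
rewrite in_solset => sb BM; exact: (hB (existT _ M (join b e))).
Qed.

End Cells.

Section FirstCell.
Variables (R : realType) (L : language) (W : Type) (T : Type).
Variables (p : T -> nat * R) (theta : T -> formula L W).

(** It expresses that the first cell of the list to hold has the pair [q]. Cells with equal pairs
    are thereby merged, as required by formulas that are indexed by pairs. *)
Fixpoint first_cell (s : seq T) (q : nat * R) : formula L W :=
  if s is t :: s' then
    if p t == q then FOr (theta t) (first_cell s' q)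
    else FAnd (FNot (theta t)) (first_cell s' q)
  else FFalse.

Lemma sat_first_cell (M : structure L) (e : W -> M) s :
  has (fun t => sat (theta t) e) s ->
  exists2 t, sat (theta t) e & forall q, sat (first_cell s q) e = (p t == q).
Proof.
elim: s => //= t s IH; case: (boolP (sat (theta t) e)) => [st _|/negbTE E /IH[u su hu]].
  by exists t => // q; case: ifP => _; rewrite ?sat_FOr /= st.
by exists u => // q; rewrite -hu; case: ifP => _; rewrite ?sat_FOr /= E.
Qed.

End FirstCell.

Lemma sized_definable_sizes (R : realType) (L : language) (N : nat)
    (C : class_of_structures L) n m (phi : formula L ('I_n + 'I_m)) :
  sized R N C (N * n) (fun M (e : 'I_m -> M) => #|solset phi e|) ->
  exists (D : seq (nat * R)) (theta : nat * R -> formula L 'I_m),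
    definable_sizes N C phi D theta.
Proof.
move=> [T [p [theta [ok cov as_]]]].
exists [seq p t | t <- enum T], (first_cell p theta (enum T)).
have cell M (CM : C M) (e : 'I_m -> M) : exists2 t, sat (theta t) e &
    forall q, sat (first_cell p theta (enum T) q) e = (p t == q).
  apply: sat_first_cell; have [t ht] := cov M CM e.
  by apply/hasP; exists t; rewrite ?mem_enum.
split.
- by move=> _ /mapP[t _ ->]; apply: ok.
- move=> M CM e; have [t _ ht] := cell M CM e; exists (p t).
  split; first by rewrite ht eqxx; split=> //; apply: map_f; rewrite mem_enum.
  by move=> q []; rewrite ht => _ /eqP.
- move=> q _ eps eps0.
  (* A merged cell may draw on several indices t, so the largest of their thresholds is taken. *)
  have [B hB] := choice (fun t => as_ t eps eps0).
  exists (\max_t B t)%N => M e [CM]; have [t st ->] := cell M CM e.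
  move=> /eqP <- BM; apply: (hB t (existT _ M _)) => //=.
  by apply: leq_ltn_trans BM; apply: leq_bigmax.
Qed.

(** * Translation of formulas along selected representatives *)

Section Translation.
Variables (L L' : language) (C : class_of_structures L) (D : class_of_structures L').
Variables (r s : nat) (I : interpretation C D r s) (sigma : formula L ('I_r + 'I_s)).
Hypothesis sel : is_selector I sigma.

Section Representatives.
Variable A : member D.

Let P := def_quotient (idom I) (ieq I) (param I A).

Lemma iso_quotient (a : A) : iso I a \in P.
Proof. by rewrite /P -iso_im imset_f. Qed.

Lemma rep_ex (a : A) :
  exists u, (u \in defset sigma (param I A)) && (u \in iso I a).
Proof.
have /and3P[_ _ /forall_inP/(_ _ (iso_quotient a))/cards1P[u hu]] := sel A.
by exists u; have := set11 u; rewrite -hu inE.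
Qed.

Definition rep (a : A) : {ffun 'I_r -> alpha I A} := xchoose (rep_ex a).

Lemma rep_sel a : rep a \in defset sigma (param I A).
Proof. by have /andP[] := xchooseP (rep_ex a). Qed.

Lemma rep_iso a : rep a \in iso I a.
Proof. by have /andP[] := xchooseP (rep_ex a). Qed.

Lemma rep_uniq a u : u \in defset sigma (param I A) -> u \in iso I a -> u = rep a.
Proof.
move=> us ua.
have /and3P[_ _ /forall_inP/(_ _ (iso_quotient a))/cards1P[v hv]] := sel A.
have uv w : w \in defset sigma (param I A) -> w \in iso I a -> w = v.
  by move=> ws wa; apply/set1P; rewrite -hv inE ws.
by rewrite (uv u) // (uv (rep a)) ?rep_sel ?rep_iso.
Qed.

Lemma rep_onto u : u \in defset sigma (param I A) -> exists a, u = rep a.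
Proof.
move=> us; have /and3P[/and3P[/eqP covP _ _] /fintype.subsetP/(_ _ us) uX _] := sel A.
move: uX; rewrite -covP => /finset.bigcupP[B]; rewrite -iso_im => /imsetP[a _ ->] ua.
by exists a; apply: rep_uniq.
Qed.

Lemma def_rel_rep a b : def_rel (ieq I) (param I A) (rep a) (rep b) = (a == b).
Proof.
have /and3P[/and3P[/eqP covP trivP _] /fintype.subsetP SX _] := sel A.
rewrite -(pblock_equivalence_partition (@ieq_equiv _ _ _ _ _ _ I A)) ?SX ?rep_sel //.
rewrite (def_pblock trivP (iso_quotient a) (rep_iso a)).
apply/idP/eqP => [ba|->]; last exact: rep_iso.
apply: (@iso_inj _ _ _ _ _ _ I A).
rewrite -(def_pblock trivP (iso_quotient a) ba).
by rewrite (def_pblock trivP (iso_quotient b) (rep_iso b)).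
Qed.

Lemma rep_inj : injective rep.
Proof.
by move=> a b ab; apply/eqP; rewrite -def_rel_rep -ab def_rel_rep.
Qed.

Lemma card_selector : #|defset sigma (param I A)| = #|A|.
Proof.
rewrite -(card_imset _ rep_inj); apply: eq_card => u.
apply/idP/imsetP => [/rep_onto[a ->]|[a _ ->]]; first by exists a.
exact: rep_sel.
Qed.

(** This is [flat] applied to the selected representatives, the form of assignment that
    [trace_reflecting] speaks about. *)
Definition reps (V : Type) (e : V -> A) (p : V * 'I_r) : alpha I A := rep (e p.1) p.2.

End Representatives.

Definition selected (V : Type) : formula L ('I_r + (V + 'I_s)) :=
  rename sigma (fun z => match z with inl i => inl i | inr k => inr (inr k) end).

Lemma sat_selected (A : member D) (V : Type) (b : {ffun 'I_r -> alpha I A})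
    (e : V -> alpha I A) :
  sat (selected V) (join b (join e (param I A))) = (b \in defset sigma (param I A)).
Proof.
by rewrite sat_rename inE; congr (sat _ _); apply/funext; case.
Qed.

(** Quantifiers are relativized to the selector instead of the whole domain, so each element of A is
    represented by exactly one tuple. *)
Fixpoint translate (V : Type) (f : formula L' V) : formula L (V * 'I_r + 'I_s) :=
  match f with
  | FFalse => FFalse
  | FEq x y => rename (ieq I) (fun z => match z with
      | inl (inl i) => inl (x, i)
      | inl (inr i) => inl (y, i)
      | inr k => inr k end)
  | FSort k x => rename (isort I k) (fun z => match z with
      | inl i => inl (x, i)
      | inr k => inr k end)
  | FRel Q t => rename (irel I Q) (fun z => match z with
      | inl (i, j) => inl (t i, j)
      | inr k => inr k end)
  | FNot f1 => FNot (translate f1)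
  | FAnd f1 f2 => FAnd (translate f1) (translate f2)
  | FEx f1 => FExs (FAnd
      (selected _) (rename (translate f1) (fun z => match z with
        | inl (Some v, i) => inr (inl (v, i))
        | inl (None, i) => inl i
        | inr k => inr (inr k) end)))
  end.

Lemma sat_translate (A : member D) (V : Type) (f : formula L' V) (e : V -> A) :
  sat (translate f) (join (reps e) (param I A)) = sat f e.
Proof.
elim: V / f e => //=.
- move=> V x y e; rewrite -def_rel_rep sat_rename /def_rel; congr (sat _ _).
  by apply/funext; case=> [[]|].
- move=> V k x e; rewrite sat_rename (iso_sort k (rep_iso (e x))); congr (sat _ _).
  by apply/funext; case.
- move=> V Q t e; rewrite sat_rename.
  rewrite (@iso_rel _ _ _ _ _ _ I A Q _ (fun i => rep (e (t i)))); last first.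
    by move=> i; rewrite ffunE; apply: rep_iso.
  by congr (sat _ _); apply/funext; case=> [[]|].
- by move=> V f IH e; rewrite IH.
- by move=> V f IHf g IHg e; rewrite IHf IHg.
move=> V f IH e; rewrite sat_FExs.
apply/existsP/existsP => [[b] /=|[x sx]].
  rewrite sat_selected sat_rename => /andP[/rep_onto[x ->] sf].
  exists x; rewrite -IH; move: sf; congr (is_true (sat _ _)); apply/funext.
  by case=> [[[v|] i]|k].
exists (rep x); rewrite /= sat_selected rep_sel sat_rename /=.
rewrite -IH in sx; move: sx; congr (is_true (sat _ _)); apply/funext.
by case=> [[[v|] i]|k].
Qed.

Definition translate1 m (phi : formula L' ('I_1 + 'I_m)) :
    formula L ('I_r + ('I_m * 'I_r + 'I_s)) :=
  FAnd (selected _) (rename (translate phi) (fun z => match z with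
      | inl (inl _, j) => inl j
      | inl (inr v, j) => inr (inl (v, j))
      | inr k => inr (inr k) end)).

(** Taking selected representatives is a bijection between the two sets. The count is exact,
    whatever the sizes of the equivalence classes. *)
Lemma card_translate1 (A : member D) m (phi : formula L' ('I_1 + 'I_m)) (e : 'I_m -> A) :
  #|solset (translate1 phi) (join (reps e) (param I A))| = #|solset phi e|.
Proof.
have inj1 : injective (fun b : {ffun 'I_1 -> A} => rep (b ord0)).
  by move=> b c /rep_inj bc; apply/ffunP=> i; rewrite (ord1 i).
rewrite -(card_imset _ inj1); apply: eq_card => u.
have repE (b : {ffun 'I_1 -> A}) :
    sat (translate1 phi) (join (rep (b ord0)) (join (reps e) (param I A))) = sat phi (join b e).
  rewrite /= sat_selected rep_sel sat_rename -(sat_translate phi (join b e)) /=.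
  congr (sat _ _); apply/funext.
  by case=> [[[i|v] j]|k] //=; rewrite /reps /= (ord1 i).
rewrite in_solset; apply/idP/imsetP => [su|[b]]; last first.
  by rewrite in_solset -repE => sb ->.
have [a ua] : exists a, u = rep a.
  by apply: rep_onto; move: su; rewrite /= sat_selected => /andP[].
exists [ffun=> a]; last by rewrite ffunE.
by rewrite in_solset -repE ffunE -ua.
Qed.

End Translation.

(** * Asymptotic cells for the interpreted class *)

Section Transfer.
Variables (R : realType) (L L' : language) (N : nat).
Variables (C : class_of_structures L) (D : class_of_structures L') (r s : nat).
Variables (I : interpretation C D r s) (sigma : formula L ('I_r + 'I_s)).
Hypothesis aC : asymptotic_class R N C.
Hypothesis sel : is_selector I sigma.
Hypothesis trace : trace_reflecting I sigma.
Variables (P : seq (nat * R)) (chi : nat * R -> formula L 'I_s).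
Hypothesis chiP : definable_sizes N C sigma P chi.

Lemma leq_card_alpha (A : member D) : (#|A| <= #|alpha I A| ^ r)%N.
Proof.
rewrite -(card_selector sel); apply: leq_trans (max_card _) _.
by rewrite card_ffun card_ord.
Qed.

Lemma asymp_selector (J : Type) (f : J -> member D) u : u \in P ->
  asymp N (fun j => #|alpha I (f j)|) (fun j => sat (chi u) (param I (f j)))
    (fun j => #|f j|%:R) u.
Proof.
move=> uP; have [_ _ as_] := definable_sizes_cells chiP.
have := asymp_map (fun j => existT (fun M : structure L => 'I_s -> M)
  (alpha I (f j)) (param I (f j))) (as_ (SeqSub uP)).
move=> h eps /h[B hB]; exists B => j sj Bj.
by have := hB j (conj (strP _) sj) Bj; rewrite /= (card_selector sel).
Qed.

Lemma inessential_bounded u : u \in P -> (0 < u.1)%N -> 0 < u.2 ->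
  ~ essential_dim I P chi u.1 ->
  exists B : nat, forall A : member D, sat (chi u) (param I A) -> (#|A| <= B)%N.
Proof.
move=> uP u1 u2 ness; apply: contrapT => nB; apply: ness; split=> //.
exists u.2; rewrite -surjective_pairing; split=> // B.
apply: contrapT => nA; apply: nB; exists B => A sA; rewrite leqNgt; apply/negP.
by move=> BA; apply: nA; exists A.
Qed.

Variable K : nat.
Hypothesis K_gt0 : (0 < K)%N.
Hypothesis essK : forall e, essential_dim I P chi e -> (e %| K)%N.

(* The last case only occurs on cells where #|A| is bounded, so that any pair
   would do. *)
Definition transfer_pair (u p : nat * R) : nat * R :=
  if p.2 == 0 then (0%N, 0)
  else if [&& (0 < u.1)%N, (u.1 %| K)%N & (p.1 <= u.1)%N]
  then ((p.1 * (K %/ u.1))%N, p.2 / u.2 `^ (p.1%:R / u.1%:R))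
  else (0%N, 1).

Lemma okpair_pos H (u : nat * R) : okpair H u -> (0 < u.1)%N -> 0 < u.2.
Proof. by case=> [[]|->]. Qed.

Lemma okpair_transfer H H' u p : okpair H u -> okpair H' p ->
  okpair K (transfer_pair u p).
Proof.
rewrite /transfer_pair => oku okp; case: eqP => [_|/(okpair_gt0 okp)[_ p0]].
  by right.
case: ifP => [/and3P[u0 uK pu]|_]; last by left; rewrite ltr01.
left; split=> /=; last by rewrite divr_gt0 // powR_gt0 // (okpair_pos oku).
by rewrite -{2}(divnK uK) mulnC leq_mul2l pu orbT.
Qed.

Lemma asymp_transfer_pair (J : Type) (f : J -> member D) (Phi : J -> Prop)
    (F : J -> R) H H' u p : u \in P -> okpair H u -> okpair H' p ->
  (forall j, Phi j -> sat (chi u) (param I (f j))) ->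
  (forall j, Phi j -> F j <= #|f j|%:R) ->
  asymp N (fun j => #|alpha I (f j)|) Phi F p ->
  asymp K (fun j => #|f j|) Phi F (transfer_pair u p).
Proof.
move=> uP oku okp Pu FA aF; have N0 := aC.1; have r0 := arity_gt0 I.
have leYX j : Phi j -> (#|f j| <= #|alpha I (f j)| ^ r)%N.
  by move=> _; apply: leq_card_alpha.
have aY := asymp_sub Pu (asymp_selector f uP).
rewrite /transfer_pair; case: eqP => [/(okpair0 okp) p0|/(okpair_gt0 okp)[_ p0]].
  by rewrite {}p0 in aF; exact (asymp_transfer0 r0 leYX K aF).
case: ifP => [/and3P[u0 uK pu]|/negbT nuK].
  have u20 := okpair_pos oku u0.
  case: u p {uP oku okp Pu} aY aF u0 uK pu p0 u20 => [e lam] [d mu] /= aY aF u0 uK pu p0 u20.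
  exact (asymp_transfer r0 leYX N0 K_gt0 u0 uK pu p0 u20 aY aF).
(* The test in [transfer_pair] fails in three ways, each bounding |A|: the selector has exponent 0,
   its exponent does not divide K and so is inessential, or the subset would outgrow A. *)
suff [B hB] : exists B : nat, forall j, Phi j -> (#|f j| <= B)%N.
  exact: asymp_bounded hB.
have [u0|u0] := posnP u.1.
  case: u aY u0 {uP oku Pu nuK} => [e lam] aY /= e0; rewrite e0 in aY.
  exact: (transfer_bounded0 r0 leYX aY).
move: nuK; rewrite u0 /=; case: (boolP (u.1 %| K)%N) => /= [_|uK _].
  rewrite -ltnNge => up; case: u p {uP oku okp Pu} aY aF up p0 u0 => [e lam] [d mu] /=.
  by move=> aY aF up p0 _; apply: (transfer_bounded_lt r0 leYX N0 up p0 FA aF aY).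
have [B hB] := @inessential_bounded u uP u0 (okpair_pos oku u0)
  (fun ess => negP uK (essK ess)).
by exists B => j /Pu; apply: hB.
Qed.

(** K is only required to be a positive common multiple of the essential dimensions, so both
    denominators of the theorem are instances. *)
Lemma asymptotic_class_transfer : asymptotic_class R K D.
Proof.
split=> // m phi; apply: sized_definable_sizes; rewrite muln1.
have N0 := aC.1.
have [T [p [theta [okp cov as_]]]] := sized_solset N0 (translate1 I sigma phi) aC.
have [oku covu _] := definable_sizes_cells chiP.
(* Both the coefficient and the exponent depend on the selector cell of [param], which A does not
   see; hence [chi] is reflected together with [theta]. *)
have [rho rhoE] := choice (fun ut : seq_sub P * T =>
  trace (FAnd (rename (chi (ssval ut.1)) inr) (theta ut.2))).
have {}rhoE ut (A : member D) (e : 'I_m -> A) : sat (rho ut) e =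
    sat (chi (ssval ut.1)) (param I A)
    && sat (theta ut.2) (join (reps sel e) (param I A)).
  have := rhoE ut A [ffun i => e i] (fun i => rep sel (e i)).
  have -> : [ffun i => e i] = e :> ('I_m -> A) by apply/funext=> i; rewrite ffunE.
  rewrite /= sat_rename => h; apply/idP/idP; apply h => i.
    by split; [apply: rep_sel | apply: rep_iso].
  by split; [apply: rep_sel | apply: rep_iso].
exists (seq_sub P * T)%type, (fun ut => transfer_pair (ssval ut.1) (p ut.2)), rho.
split.
- by move=> ut; apply: okpair_transfer (oku ut.1) (okp ut.2).
- move=> A DA e; pose A' := Member DA.
  have [u hu] := covu _ (strP (alpha I A')) (param I A').
  have [t ht] := cov _ (strP (alpha I A')) (join (reps sel (e : 'I_m -> A')) (param I A')).
  by exists (u, t); rewrite (@rhoE (u, t) A') hu ht.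
- move=> [u t].
  have := @asymp_transfer_pair {A : member D & 'I_m -> A} (fun j => tag j)
    (fun j => sat (rho (u, t)) (tagged j)) (fun j => #|solset phi (tagged j)|%:R)
    _ _ (ssval u) (p t) (ssvalP u) (oku u) (okp t).
  move=> h eps /h[||| B hB].
  + by move=> [A e]; rewrite rhoE => /andP[].
  + move=> [A e] _; rewrite ler_nat; apply: leq_trans (max_card _) _.
    by rewrite card_ffun card_ord expn1.
  + have := asymp_map (fun j : {A : member D & 'I_m -> A} =>
      existT (fun M : structure L => _ -> M) (alpha I (tag j) : structure L)
        (join (reps sel (tagged j)) (param I (tag j)))) (as_ t).
    move=> {}h eps' /h[B hB]; exists B => -[A e]; rewrite rhoE => /andP[_ st] BA.
    have := hB (existT _ A e) (conj (strP _) st) BA.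
    by rewrite /= card_translate1.
  + exists B => -[A e] /= [DA se] BA.
    exact: (hB (existT (fun A : member D => 'I_m -> A) (Member DA) e)).
Qed.

End Transfer.

Lemma dvdn_biglcm (s : seq nat) e : e \in s -> (e %| \big[lcmn/1%N]_(i <- s) i)%N.
Proof. by move=> es; rewrite (big_rem e) //= dvdn_lcml. Qed.

Lemma biglcm_dvdn (T : Type) (s : seq T) (Q : pred T) (F : T -> nat) k :
  (forall i, Q i -> F i %| k)%N -> (\big[lcmn/1%N]_(i <- s | Q i) F i %| k)%N.
Proof.
by move=> h; apply: (big_ind (fun n => n %| k)%N) => // a b; rewrite dvdn_lcm => -> ->.
Qed.

Theorem theoremA (R : realType) (L L' : language) (N : nat)
    (C : class_of_structures L) (D : class_of_structures L') (r s : nat)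
    (I : interpretation C D r s) (sigma : formula L ('I_r + 'I_s)) :
  asymptotic_class R N C ->
  is_selector I sigma ->
  trace_reflecting I sigma ->
  asymptotic_class R (\big[lcmn/1%N]_(1 <= i < (N * r).+1) i) D /\
  (exists (P : seq (nat * R)) (chi : nat * R -> formula L 'I_s),
     definable_sizes N C sigma P chi) /\
  (forall (P : seq (nat * R)) (chi : nat * R -> formula L 'I_s),
     definable_sizes N C sigma P chi ->
     asymptotic_class R (selector_lcm I P chi) D /\
     (selector_lcm I P chi %| \big[lcmn/1%N]_(1 <= i < (N * r).+1) i)%N).
Proof.
move=> aC sel trace.
have lcm_gt0 : (0 < \big[lcmn/1%N]_(1 <= i < (N * r).+1) i)%N.
  rewrite big_nat; apply: (big_ind (fun n => 0 < n)%N) => // [a b a0 b0|i /andP[] //].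
  by rewrite lcmn_gt0 a0.
(* The selector is a set of r-tuples, so [sizes_range] bounds its exponents by N * r; this is the
   origin of the range 1, ..., Nr. *)
have ess_dvd (P : seq (nat * R)) chi : definable_sizes N C sigma P chi -> forall e,
    essential_dim I P chi e -> (e %| \big[lcmn/1%N]_(1 <= i < (N * r).+1) i)%N.
  move=> ds e [e0 [lam [lam0 eP _]]]; apply: dvdn_biglcm.
  rewrite mem_index_iota e0 ltnS.
  by case: (sizes_range ds eP) => [[]|[ee]] //; rewrite ee in e0.
have [P [chi ds]] : exists (P : seq (nat * R)) (chi : nat * R -> formula L 'I_s),
    definable_sizes N C sigma P chi.
  by apply: sized_definable_sizes; exact (sized_solset aC.1 sigma aC).
split; first exact (asymptotic_class_transfer aC sel trace ds lcm_gt0 (ess_dvd P chi ds)).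
split; first by exists P, chi.
move=> {ds}P {}chi ds.
have dvd : (selector_lcm I P chi %| \big[lcmn/1%N]_(1 <= i < (N * r).+1) i)%N.
  by apply: biglcm_dvdn => q /asboolP; apply: ess_dvd.
split=> //; apply: (asymptotic_class_transfer aC sel trace ds).
  exact: dvdn_gt0 lcm_gt0 dvd.
move=> e ess; have [_ [lam [_ eP _]]] := ess.
by rewrite /selector_lcm (big_rem (e, lam)) //=; case: asboolP => // _; apply: dvdn_lcml.
Qed.
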